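(* Let $K$ be a field, $\lambda\in K$, and let $(A,\mu,\Delta,\alpha,\beta,\psi,\omega)$ be a $\lambda$-infBH-bialgebra over $K$. Then $(A,\star,\alpha^2\beta,\alpha^2\beta^2\psi\omega)$ is a (left) BiHom-pre-Lie algebra, where $\star:A\otimes A\to A$ is given by $$a\star b=\big(\beta^2\psi(b_1)\,\alpha(a)\big)\,\alpha^2\beta\omega(b_2),\qquad a,b\in A.$$
   Context: Write $ab=\mu(a\otimes b)$ and $\Delta(a)=a_1\otimes a_2$ (Sweedler notation). A $\lambda$-infBH-bialgebra $(A,\mu,\Delta,\alpha,\beta,\psi,\omega)$ consists of a vector space $A$ and linear maps $\mu:A\otimes A\to A$, $\Delta:A\to A\otimes A$, $\alpha,\beta,\psi,\omega:A\to A$ (not assumed invertible) such that: (i) (BiHom-associative algebra) $\alpha\beta=\beta\alpha$, $\alpha(ab)=\alpha(a)\alpha(b)$, $\beta(ab)=\beta(a)\beta(b)$, $\alpha(a)(bc)=(ab)\beta(c)$; (ii) (BiHom-coassociative coalgebra) $\psi\omega=\omega\psi$, $(\psi\otimes\psi)\Delta=\Delta\psi$, $(\omega\otimes\omega)\Delta=\Delta\omega$, $(\Delta\otimes\psi)\Delta=(\omega\otimes\Delta)\Delta$; (iii) $\alpha,\beta$ commute with $\psi,\omega$; $(\alpha\otimes\alpha)\Delta=\Delta\alpha$, $(\beta\otimes\beta)\Delta=\Delta\beta$; $\psi(ab)=\psi(a)\psi(b)$, $\omega(ab)=\omega(a)\omega(b)$; (iv) $\Delta(ab)=\omega(a)b_1\otimes\beta(b_2)+\alpha(a_1)\otimes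 a_2\psi(b)+\lambda\,\alpha\omega(a)\otimes\beta\psi(b)$. A (left) BiHom-pre-Lie algebra $(A,\cdot,\alpha',\beta')$ consists of a vector space $A$ and linear maps $\cdot:A\otimes A\to A$, $\alpha',\beta':A\to A$ with $\alpha'\beta'=\beta'\alpha'$, $\alpha'(a\cdot b)=\alpha'(a)\cdot\alpha'(b)$, $\beta'(a\cdot b)=\beta'(a)\cdot\beta'(b)$ and $$\alpha'\beta'(a)\cdot(\alpha'(b)\cdot c)-(\beta'(a)\cdot\alpha'(b))\cdot\beta'(c)=\alpha'\beta'(b)\cdot(\alpha'(a)\cdot c)-(\beta'(b)\cdot\alpha'(a))\cdot\beta'(c)$$ for all $a,b,c\in A$. *)

(* Defs.v *)
From HB Require Import structures.
From mathcomp Require Import all_boot all_algebra boolp.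

Set Implicit Arguments.
Unset Strict Implicit.
Unset Printing Implicit Defensive.

Import GRing.Theory.

Local Open Scope ring_scope.
Local Open Scope quotient_scope.

Definition bilin (K : fieldType) (U V W : lmodType K) (f : U -> V -> W) : Prop :=
  (forall v, linear (f ^~ v)) /\ (forall u, linear (f u)).

(* MathComp has no tensor product of arbitrary vector spaces.  An element of
   U ⊗ V is a class of formal sums of pairs (finite sequences), modulo the
   congruence generated by commutativity of the formal sum and by bilinearity.
   The universal property is tens_bilin, tlift_tens, tlift_is_linear and
   tlift_unique below. *)
Section TensorProduct.
Variables (K : fieldType) (U V : lmodType K).
Implicit Types (s t : seq (U * V)) (u : U) (v : V) (k : K).

Inductive tens_rel : seq (U * V) -> seq (U * V) -> Prop :=
| tens_refl s : tens_rel s s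
| tens_sym s t : tens_rel s t -> tens_rel t s
| tens_trans s t r : tens_rel s t -> tens_rel t r -> tens_rel s r
| tens_cat s s' t t' :
    tens_rel s s' -> tens_rel t t' -> tens_rel (s ++ t) (s' ++ t')
| tens_catC s t : tens_rel (s ++ t) (t ++ s)
| tens_zero v : tens_rel [:: (0, v)] [::]
| tens_addl u u' v : tens_rel [:: (u + u', v)] [:: (u, v); (u', v)]
| tens_addr u v v' : tens_rel [:: (u, v + v')] [:: (u, v); (u, v')]
| tens_scale k u v : tens_rel [:: (k *: u, v)] [:: (u, k *: v)].

Definition tens_eqv : rel (seq (U * V)) := fun s t => `[< tens_rel s t >].

Lemma tens_eqv_refl : reflexive tens_eqv.
Proof. by move=> s; apply/asboolP/tens_refl. Qed.

Lemma tens_eqv_sym : symmetric tens_eqv.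
Proof.
by move=> s t; apply/idP/idP => /asboolP h; apply/asboolP/tens_sym.
Qed.

Lemma tens_eqv_trans : transitive tens_eqv.
Proof.
by move=> t s r /asboolP h1 /asboolP h2; apply/asboolP; apply: tens_trans h1 h2.
Qed.

Canonical tens_equiv :=
  EquivRel tens_eqv tens_eqv_refl tens_eqv_sym tens_eqv_trans.

Definition tensor : Type := {eq_quot tens_equiv}.

HB.instance Definition _ := Choice.on tensor.
HB.instance Definition _ := EqQuotient.on tensor.

Definition tclass s : tensor := \pi_tensor s.

Lemma tclassP s t : tens_rel s t <-> tclass s = tclass t.
Proof.
split=> [h|/eqmodP/asboolP //].
by apply/eqmodP; apply/asboolP.
Qed.

Lemma tclassK (x : tensor) : tclass (repr x) = x.
Proof. exact: reprK. Qed.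

Lemma repr_tclass s : tens_rel (repr (tclass s)) s.
Proof. by apply/tclassP; rewrite tclassK. Qed.

Definition scale_seq k s := [seq (k *: p.1, p.2) | p <- s].

Definition tzero : tensor := tclass [::].
Definition tadd (x y : tensor) : tensor := tclass (repr x ++ repr y).
Definition tscale k (x : tensor) : tensor := tclass (scale_seq k (repr x)).
Definition topp (x : tensor) : tensor := tscale (-1) x.

Lemma tens_rel_scale k s t :
  tens_rel s t -> tens_rel (scale_seq k s) (scale_seq k t).
Proof.
elim=> {s t} /=.
- by move=> s; apply: tens_refl.
- by move=> s t _; apply: tens_sym.
- by move=> s t r _ h1 _; apply: tens_trans.
- by move=> s s' t t' _ h1 _ h2; rewrite /scale_seq !map_cat; apply: tens_cat.
- by move=> s t; rewrite /scale_seq !map_cat; apply: tens_catC.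
- by move=> v; rewrite scaler0; apply: tens_zero.
- by move=> u u' v; rewrite scalerDr; apply: tens_addl.
- by move=> u v v'; apply: tens_addr.
- by move=> l u v; rewrite scalerA mulrC -scalerA; apply: tens_scale.
Qed.

Lemma tadd_class s t : tadd (tclass s) (tclass t) = tclass (s ++ t).
Proof. by apply/tclassP; apply: tens_cat; apply: repr_tclass. Qed.

Lemma tscale_class k s : tscale k (tclass s) = tclass (scale_seq k s).
Proof. by apply/tclassP; apply: tens_rel_scale; apply: repr_tclass. Qed.

Lemma taddA : associative tadd.
Proof.
move=> x y z; rewrite -(tclassK x) -(tclassK y) -(tclassK z).
by rewrite !tadd_class catA.
Qed.

Lemma taddC : commutative tadd.
Proof. by move=> x y; apply/tclassP; apply: tens_catC. Qed.

Lemma tadd0 : left_id tzero tadd.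
Proof. by move=> x; rewrite -(tclassK x) tadd_class. Qed.

Lemma tens_cons p r s t :
  tens_rel [:: p] r -> tens_rel s t -> tens_rel (p :: s) (r ++ t).
Proof. by rewrite -cat1s; apply: tens_cat. Qed.

Lemma tscaleDl x k l : tscale (k + l) x = tadd (tscale k x) (tscale l x).
Proof.
rewrite -(tclassK x) !tscale_class tadd_class; apply/tclassP.
elim: (repr x) => [|[u v] s ih] /=; first exact: tens_refl.
apply: (@tens_trans _ ([:: (k *: u, v); (l *: u, v)] ++
                       (scale_seq k s ++ scale_seq l s))).
  by apply: tens_cons ih; rewrite scalerDl; apply: tens_addl.
apply: (@tens_cons _ [:: _]); first exact: tens_refl.
rewrite -[X in tens_rel _ (_ ++ X)]cat1s -cat1s !catA.
by apply: tens_cat; [apply: tens_catC | apply: tens_refl].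
Qed.

Lemma tscale0 x : tscale 0 x = tzero.
Proof.
rewrite -(tclassK x) tscale_class; apply/tclassP.
elim: (repr x) => [|[u v] s ih] /=; first exact: tens_refl.
by rewrite scale0r; apply: (@tens_cons _ [::]) ih; apply: tens_zero.
Qed.

Lemma tscale1 : left_id 1 tscale.
Proof.
move=> x; rewrite -{1}(tclassK x) tscale_class /scale_seq.
rewrite (eq_map (g := id)) ?map_id ?tclassK // => -[u v] /=.
by rewrite scale1r.
Qed.

Lemma taddN : left_inverse tzero topp tadd.
Proof.
by move=> x; rewrite -{2}(tscale1 x) /topp -tscaleDl addNr tscale0.
Qed.

HB.instance Definition _ := GRing.isZmodule.Build tensor taddA taddC tadd0 taddN.

Lemma tscaleA k l (x : tensor) : tscale k (tscale l x) = tscale (k * l) x.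
Proof.
rewrite -(tclassK x) !tscale_class /scale_seq -map_comp.
by congr tclass; apply: eq_map => -[u v] /=; rewrite scalerA.
Qed.

Lemma tscaleDr : right_distributive tscale (+%R : tensor -> tensor -> tensor).
Proof.
move=> k x y; rewrite -(tclassK x) -(tclassK y).
by rewrite [_ + _]tadd_class !tscale_class [RHS]tadd_class /scale_seq map_cat.
Qed.

HB.instance Definition _ :=
  GRing.Zmodule_isLmodule.Build K tensor tscaleA tscale1 tscaleDr
    (fun x => tscaleDl x).

Definition tens u v : tensor := tclass [:: (u, v)].

Lemma tens_bilin : bilin tens.
Proof.
split=> [v k u u' | u k v v'].
  rewrite -[RHS]/(tadd (tscale k (tens u v)) (tens u' v)).
  by rewrite tscale_class tadd_class; apply/tclassP; apply: tens_addl.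
rewrite -[RHS]/(tadd (tscale k (tens u v)) (tens u v')).
rewrite tscale_class tadd_class; apply/tclassP.
apply: tens_trans (tens_addr _ _ _) _.
by apply: (@tens_cons _ [:: _]);
  [apply: tens_sym; apply: tens_scale | apply: tens_refl].
Qed.

Lemma tclassE s : tclass s = \sum_(p <- s) tens p.1 p.2.
Proof.
elim: s => [|[u v] s ih]; first by rewrite big_nil.
by rewrite big_cons -ih [RHS]tadd_class.
Qed.

(* For f bilinear this is the linear map U ⊗ V -> W with u ⊗ v |-> f u v, so
   [tlift (fun x y => E) (Delta a)] is the Sweedler expression E(a_1, a_2).
   It is independent of the choice of [repr] when f is bilinear (tlift_class),
   and it is only meaningful in that case. *)
Definition tlift (W : lmodType K) (f : U -> V -> W) (x : tensor) : W :=
  \sum_(p <- repr x) f p.1 p.2.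

Section Lift.
Variables (W : lmodType K) (f : U -> V -> W).
Hypothesis f_bilin : bilin f.

Lemma bilinDl u u' v : f (u + u') v = f u v + f u' v.
Proof. by have := f_bilin.1 v 1 u u'; rewrite !scale1r. Qed.

Lemma bilinDr u v v' : f u (v + v') = f u v + f u v'.
Proof. by have := f_bilin.2 u 1 v v'; rewrite !scale1r. Qed.

Lemma bilin0l v : f 0 v = 0.
Proof. by apply: (addrI (f 0 v)); rewrite -bilinDl !addr0. Qed.

Lemma bilin0r u : f u 0 = 0.
Proof. by apply: (addrI (f u 0)); rewrite -bilinDr !addr0. Qed.

Lemma bilinZl k u v : f (k *: u) v = k *: f u v.
Proof. by have := f_bilin.1 v k u 0; rewrite !addr0 bilin0l addr0. Qed.

Lemma bilinZr k u v : f u (k *: v) = k *: f u v.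
Proof. by have := f_bilin.2 u k v 0; rewrite !addr0 bilin0r addr0. Qed.

Lemma tens_rel_sum s t :
  tens_rel s t -> \sum_(p <- s) f p.1 p.2 = \sum_(p <- t) f p.1 p.2.
Proof.
elim=> {s t} //=.
- by move=> s t r _ -> _ ->.
- by move=> s s' t t' _ h1 _ h2; rewrite !big_cat /= h1 h2.
- by move=> s t; rewrite !big_cat /= addrC.
- by move=> v; rewrite big_cons !big_nil /= bilin0l addr0.
- by move=> u u' v; rewrite !big_cons !big_nil /= !addr0 bilinDl.
- by move=> u v v'; rewrite !big_cons !big_nil /= !addr0 bilinDr.
- by move=> k u v; rewrite !big_cons !big_nil /= !addr0 bilinZl bilinZr.
Qed.

Lemma tlift_class s : tlift f (tclass s) = \sum_(p <- s) f p.1 p.2.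
Proof. exact: tens_rel_sum (repr_tclass s). Qed.

Lemma tlift_tens u v : tlift f (tens u v) = f u v.
Proof. by rewrite tlift_class big_cons big_nil addr0. Qed.

Lemma tlift_is_linear : linear (tlift f).
Proof.
move=> k x y; rewrite -(tclassK x) -(tclassK y).
rewrite -[X in tlift f X]/(tadd (tscale k _) _).
rewrite tscale_class tadd_class !tlift_class big_cat /= big_map scaler_sumr; congr (_ + _).
by apply: eq_bigr => p _; rewrite bilinZl.
Qed.

Lemma tlift_unique (g : {linear tensor -> W}) :
  (forall u v, g (tens u v) = f u v) -> g =1 tlift f.
Proof.
move=> h x; rewrite -(tclassK x) tlift_class tclassE linear_sum.
by apply: eq_bigr => p _; rewrite h.
Qed.

End Lift.
End TensorProduct.

Arguments tens {K U V} u v.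

Notation "U ⊗ V" := (tensor U%type V%type)
  (at level 40, left associativity) : type_scope.
Notation "u ⊗ v" := (tens u v)
  (at level 40, left associativity) : ring_scope.

Definition tmap (K : fieldType) (U V U' V' : lmodType K)
    (f : U -> U') (g : V -> V') : U ⊗ V -> U' ⊗ V' :=
  tlift (fun u v => f u ⊗ g v).

Lemma tmap_bilin (K : fieldType) (U V U' V' : lmodType K)
    (f : {linear U -> U'}) (g : {linear V -> V'}) :
  bilin (fun u v => f u ⊗ g v).
Proof.
split=> [v k u u' | u k v v'] /=.
  by rewrite linearP (tens_bilin _ _).1.
by rewrite linearP (tens_bilin _ _).2.
Qed.

Lemma tmap_tens (K : fieldType) (U V U' V' : lmodType K)
    (f : {linear U -> U'}) (g : {linear V -> V'}) u v :
  tmap f g (u ⊗ v) = f u ⊗ g v.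
Proof. exact: tlift_tens (tmap_bilin f g) u v. Qed.

HB.instance Definition _ (K : fieldType) (U V U' V' : lmodType K)
    (f : {linear U -> U'}) (g : {linear V -> V'}) :=
  GRing.isLinear.Build K _ _ _ (tmap f g) (tlift_is_linear (tmap_bilin f g)).

Definition tassoc (K : fieldType) (U V W : lmodType K) :
    (U ⊗ V) ⊗ W -> U ⊗ (V ⊗ W) :=
  tlift (fun x w => tlift (fun u v => u ⊗ (v ⊗ w)) x).

Section TassocTheory.
Variables (K : fieldType) (U V W : lmodType K).

Lemma tassoc_inner_bilin (w : W) : bilin (fun (u : U) (v : V) => u ⊗ (v ⊗ w)).
Proof.
split=> [v k u u' | u k v v'] /=; first by rewrite (tens_bilin _ _).1.
by rewrite (tens_bilin _ _).1 (tens_bilin _ _).2.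
Qed.

Lemma tassoc_bilin : bilin (fun (x : U ⊗ V) (w : W) =>
  tlift (fun u v => u ⊗ (v ⊗ w)) x).
Proof.
split=> [w k x x' | x k w w'] /=.
  by rewrite (tlift_is_linear (tassoc_inner_bilin w)).
rewrite /tlift scaler_sumr -big_split /=; apply: eq_bigr => p _.
by rewrite 2!(tens_bilin _ _).2.
Qed.

HB.instance Definition _ := GRing.isLinear.Build K _ _ _
  (@tassoc K U V W) (tlift_is_linear tassoc_bilin).

Lemma tassoc_tens (u : U) (v : V) (w : W) :
  tassoc ((u ⊗ v) ⊗ w) = u ⊗ (v ⊗ w).
Proof.
rewrite /tassoc (tlift_tens tassoc_bilin).
exact: tlift_tens (tassoc_inner_bilin w) u v.
Qed.

End TassocTheory.

Record is_BiHom_assoc (K : fieldType) (A : lmodType K)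
    (mu : {linear (A ⊗ A)%type -> A}) (alpha beta : {linear A -> A}) : Prop := {
  bha_comm : forall a, alpha (beta a) = beta (alpha a);
  bha_alphaM : forall a b, alpha (mu (a ⊗ b)) = mu (alpha a ⊗ alpha b);
  bha_betaM : forall a b, beta (mu (a ⊗ b)) = mu (beta a ⊗ beta b);
  bha_assoc : forall a b c,
    mu (alpha a ⊗ mu (b ⊗ c)) = mu (mu (a ⊗ b) ⊗ beta c)
}.

Record is_BiHom_coassoc (K : fieldType) (A : lmodType K)
    (Delta : {linear A -> (A ⊗ A)%type}) (psi omega : {linear A -> A}) : Prop := {
  bhc_comm : forall a, psi (omega a) = omega (psi a);
  bhc_psiD : forall a, tmap psi psi (Delta a) = Delta (psi a);
  bhc_omegaD : forall a, tmap omega omega (Delta a) = Delta (omega a);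
  bhc_coassoc : forall a,
    tassoc (tmap Delta psi (Delta a)) = tmap omega Delta (Delta a)
}.

Record is_infBH_bialgebra (K : fieldType) (lambda : K) (A : lmodType K)
    (mu : {linear (A ⊗ A)%type -> A}) (Delta : {linear A -> (A ⊗ A)%type})
    (alpha beta psi omega : {linear A -> A}) : Prop := {
  infbh_assoc : is_BiHom_assoc mu alpha beta;
  infbh_coassoc : is_BiHom_coassoc Delta psi omega;
  infbh_alpha_psi : forall a, alpha (psi a) = psi (alpha a);
  infbh_alpha_omega : forall a, alpha (omega a) = omega (alpha a);
  infbh_beta_psi : forall a, beta (psi a) = psi (beta a);
  infbh_beta_omega : forall a, beta (omega a) = omega (beta a);
  infbh_alphaD : forall a, tmap alpha alpha (Delta a) = Delta (alpha a);
  infbh_betaD : forall a, tmap beta beta (Delta a) = Delta (beta a);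
  infbh_psiM : forall a b, psi (mu (a ⊗ b)) = mu (psi a ⊗ psi b);
  infbh_omegaM : forall a b, omega (mu (a ⊗ b)) = mu (omega a ⊗ omega b);
  infbh_deltaM : forall a b,
    Delta (mu (a ⊗ b)) =
      tlift (fun b1 b2 => mu (omega a ⊗ b1) ⊗ beta b2) (Delta b)
      + tlift (fun a1 a2 => alpha a1 ⊗ mu (a2 ⊗ psi b)) (Delta a)
      + lambda *: (alpha (omega a) ⊗ beta (psi b))
}.

Record is_BiHom_preLie (K : fieldType) (A : lmodType K)
    (m : {linear (A ⊗ A)%type -> A}) (alpha' beta' : {linear A -> A}) : Prop := {
  bhpl_comm : forall a, alpha' (beta' a) = beta' (alpha' a);
  bhpl_alphaM : forall a b, alpha' (m (a ⊗ b)) = m (alpha' a ⊗ alpha' b);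
  bhpl_betaM : forall a b, beta' (m (a ⊗ b)) = m (beta' a ⊗ beta' b);
  bhpl_preLie : forall a b c,
    m (alpha' (beta' a) ⊗ m (alpha' b ⊗ c))
      - m (m (beta' a ⊗ alpha' b) ⊗ beta' c) =
    m (alpha' (beta' b) ⊗ m (alpha' a ⊗ c))
      - m (m (beta' b ⊗ alpha' a) ⊗ beta' c)
}.

Section Star.
Variables (K : fieldType) (A : lmodType K).
Variables (mu : {linear (A ⊗ A)%type -> A}) (Delta : {linear A -> (A ⊗ A)%type}).
Variables (alpha beta psi omega : {linear A -> A}).

Definition star_pair (a b : A) : A :=
  tlift (fun b1 b2 =>
    mu (mu (beta (beta (psi b1)) ⊗ alpha a) ⊗ alpha (alpha (beta (omega b2)))))
    (Delta b).

Definition infbh_star : A ⊗ A -> A := tlift star_pair.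

Lemma star_inner_bilin a : bilin (fun b1 b2 =>
  mu (mu (beta (beta (psi b1)) ⊗ alpha a) ⊗ alpha (alpha (beta (omega b2))))).
Proof.
split=> [v k u u' | u k v v'] /=.
  by rewrite !linearP (tens_bilin _ _).1 linearP (tens_bilin _ _).1 linearP.
by rewrite !linearP (tens_bilin _ _).2 linearP.
Qed.

Lemma star_pair_bilin : bilin star_pair.
Proof.
split=> [b k a a' | a k b b'] /=; last first.
  by rewrite /star_pair linearP (tlift_is_linear (star_inner_bilin a)).
rewrite /star_pair /tlift scaler_sumr -big_split /=.
apply: eq_bigr => p _.
by rewrite linearP (tens_bilin _ _).2 linearP (tens_bilin _ _).1 linearP.
Qed.

HB.instance Definition _ :=
  GRing.isLinear.Build K _ _ _ infbh_star (tlift_is_linear star_pair_bilin).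

Lemma infbh_starE a b : infbh_star (a ⊗ b) = star_pair a b.
Proof. exact: tlift_tens star_pair_bilin a b. Qed.

End Star.

(* Main.v *)
Require Import Defs.
From mathcomp Require Import all_boot all_algebra.

Set Implicit Arguments.
Unset Strict Implicit.

Import GRing.Theory.
Local Open Scope ring_scope.

(** Expanding [Delta] of the triple product
    [P b ⋆ c = (β²ψ(c_1) α(P b)) α²βω(c_2)] by the compatibility condition gives
    [PQ(a) ⋆ (P(b) ⋆ c) = T1 + T2 + T3 + λ T4 + λ T5], where [P = α²β] and
    [Q = α²β²ψω].  In T1, T2 and T3 the coproduct falls on [c_2], [b] and [c_1]
    respectively.  BiHom-associativity turns T2 into [(Q(a) ⋆ P(b)) ⋆ Q(c)] and
    T4 into T5 with [a] and [b] exchanged; with BiHom-coassociativity, T1 becomes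
    T3 with [a] and [b] exchanged.  Hence the associator is symmetric in
    [a] and [b]. *)

(** * Linear maps out of tensor products *)

Section Linearity.
Variables (K : fieldType) (U V W X : lmodType K).

Lemma linear_idfun : linear (fun x : U => x).
Proof. by []. Qed.

Lemma linear_app (g : {linear V -> W}) (f : U -> V) :
  linear f -> linear (fun x => g (f x)).
Proof. by move=> hf k x y; rewrite hf linearP. Qed.

Lemma linear_tensl (f : U -> V) (w : W) : linear f -> linear (fun x => f x ⊗ w).
Proof. by move=> hf k x y; rewrite hf (tens_bilin _ _).1. Qed.

Lemma linear_tensr (v : V) (f : U -> W) : linear f -> linear (fun x => v ⊗ f x).
Proof. by move=> hf k x y; rewrite hf (tens_bilin _ _).2. Qed.

(** For every parameter the sum runs over the same representative of [t], so linearity is checked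
    summand by summand. *)
Lemma linear_tlift_param (f : X -> U -> V -> W) (t : (U ⊗ V)%type) :
  (forall u v, linear (fun x => f x u v)) -> linear (fun x => tlift (f x) t).
Proof.
move=> hf k x y; rewrite /tlift scaler_sumr -big_split.
by apply: eq_bigr => p _; rewrite hf.
Qed.

Lemma linear_tlift (f : U -> V -> W) (g : X -> (U ⊗ V)%type) :
  bilin f -> linear g -> linear (fun x => tlift f (g x)).
Proof. by move=> hf hg k x y; rewrite hg (tlift_is_linear hf). Qed.

Lemma eq_tlift (f g : U -> V -> W) (t : (U ⊗ V)%type) :
  (forall u v, f u v = g u v) -> tlift f t = tlift g t.
Proof. by move=> fg; apply: eq_bigr => p _; apply: fg. Qed.

Lemma tliftD (f : U -> V -> W) (s t : (U ⊗ V)%type) :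
  bilin f -> tlift f (s + t) = tlift f s + tlift f t.
Proof. by move=> hf; have := tlift_is_linear hf 1 s t; rewrite !scale1r. Qed.

Lemma tlift_scale (f : U -> V -> W) k (t : (U ⊗ V)%type) :
  bilin f -> tlift f (k *: t) = k *: tlift f t.
Proof.
move=> hf; have := tlift_is_linear hf k t 0.
suff -> : tlift f 0 = 0 by rewrite !addr0.
by have := tlift_is_linear hf (-1) t t; rewrite !scaleN1r !addNr.
Qed.

Lemma tliftDfun (f g : U -> V -> W) (t : (U ⊗ V)%type) :
  tlift (fun u v => f u v + g u v) t = tlift f t + tlift g t.
Proof. by rewrite /tlift big_split. Qed.

Lemma tliftZfun (f : U -> V -> W) k (t : (U ⊗ V)%type) :
  tlift (fun u v => k *: f u v) t = k *: tlift f t.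
Proof. by rewrite /tlift scaler_sumr. Qed.

Lemma linear_tliftE (h : W -> X) (f : U -> V -> W) (t : (U ⊗ V)%type) :
  linear h -> h (tlift f t) = tlift (fun u v => h (f u v)) t.
Proof.
move=> hh; have h0 : h 0 = 0.
  by have := hh (-1) 0 0; rewrite !scaleN1r !addNr.
have hD x y : h (x + y) = h x + h y by have := hh 1 x y; rewrite !scale1r.
exact: (big_morph h hD h0).
Qed.

End Linearity.

Lemma tlift_tlift (K : fieldType) (U V U' V' W : lmodType K)
    (h : U' -> V' -> W) (f : U -> V -> (U' ⊗ V')%type) (t : (U ⊗ V)%type) :
  bilin h -> tlift h (tlift f t) = tlift (fun u v => tlift h (f u v)) t.
Proof. by move=> hh; apply: linear_tliftE; apply: tlift_is_linear. Qed.

Lemma tlift_tmap (K : fieldType) (U V U' V' W : lmodType K)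
    (h : U' -> V' -> W) (f : U -> U') (g : V -> V') (t : (U ⊗ V)%type) :
  bilin h -> tlift h (tmap f g t) = tlift (fun u v => h (f u) (g v)) t.
Proof.
move=> hh; rewrite /tmap tlift_tlift //.
by apply: eq_tlift => u v; rewrite tlift_tens.
Qed.

Lemma tassoc_tensE (K : fieldType) (U V W : lmodType K) (t : (U ⊗ V)%type) (w : W) :
  tassoc (t ⊗ w) = tlift (fun u v => u ⊗ (v ⊗ w)) t.
Proof. exact: tlift_tens (tassoc_bilin U V W) t w. Qed.

(** The bound variable may occur in the tensor fed to a [tlift] or inside the function being lifted:
    [linear_tlift] serves the first case and [linear_tlift_param] the second. A branch whose
    premises cannot be closed is abandoned for the next one. *)
Ltac linear_tac :=
  lazymatch goal with
  | |- bilin _ => split=> ? /=; linear_tac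
  | |- forall _, _ => move=> ?; linear_tac
  | |- _ =>
    first [ exact: linear_idfun
          | apply: linear_tensl; linear_tac
          | apply: linear_tensr; linear_tac
          | apply: linear_tlift; linear_tac
          | apply: linear_app; linear_tac
          | apply: linear_tlift_param; linear_tac ]
  end.

(** * BiHom-coassociativity in Sweedler form *)

Section Coassociativity.
Variables (K : fieldType) (A W : lmodType K).
Variables (Delta : {linear A -> (A ⊗ A)%type}) (psi omega : {linear A -> A}).
Hypothesis coassoc : is_BiHom_coassoc Delta psi omega.

(** The trilinear [F] induces a linear map on A ⊗ (A ⊗ A), which is applied to both sides of the
    coassociativity axiom. *)
Lemma tlift_coassoc (F : A -> A -> A -> W) c :
  (forall u, bilin (F u)) -> (forall v w, linear (fun u => F u v w)) ->
  tlift (fun c1 c2 => tlift (F (omega c1)) (Delta c2)) (Delta c) =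
  tlift (fun c1 c2 => tlift (fun u v => F u v (psi c2)) (Delta c1)) (Delta c).
Proof.
move=> hF hF1.
have hH : bilin (fun u (t : (A ⊗ A)%type) => tlift (F u) t).
  by split=> [t | u]; [apply: linear_tlift_param | apply: tlift_is_linear].
rewrite -(tlift_tmap _ _ _ hH) -(bhc_coassoc coassoc) /tmap.
rewrite (linear_tliftE _ _ (@linearP _ _ _ _ (@tassoc K A A A))) tlift_tlift //.
apply: eq_tlift => c1 c2; rewrite /= tassoc_tensE.
rewrite tlift_tlift //; apply: eq_tlift => u v.
by rewrite (tlift_tens hH) (tlift_tens (hF u)).
Qed.

End Coassociativity.

Section InfBHBialgebra.
Variables (K : fieldType) (lambda : K) (A : lmodType K).
Variables (mu : {linear (A ⊗ A)%type -> A}) (Delta : {linear A -> (A ⊗ A)%type}).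
Variables (alpha beta psi omega : {linear A -> A}).
Hypothesis HA : is_infBH_bialgebra lambda mu Delta alpha beta psi omega.

Local Notation "x ∙ y" := (mu (x ⊗ y)) (at level 40, left associativity).
Local Notation star := (star_pair mu Delta alpha beta psi omega).
Local Notation "'P' x" := (alpha (alpha (beta x))) (at level 10, x at level 9).
Local Notation "'Q' x" := (alpha (alpha (beta (beta (psi (omega x))))))
  (at level 10, x at level 9).

Lemma mul_assoc a b c : alpha a ∙ (b ∙ c) = a ∙ b ∙ beta c.
Proof. exact: bha_assoc (infbh_assoc HA) a b c. Qed.

Let alphaM := bha_alphaM (infbh_assoc HA).
Let betaM := bha_betaM (infbh_assoc HA).
Let psiM := infbh_psiM HA.
Let omegaM := infbh_omegaM HA.
Let mapsM := (alphaM, betaM, psiM, omegaM).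
(** Oriented so that rewriting puts ω outermost, then ψ, then β, with α innermost; this is the order
    used in [word], so equal composites become syntactically equal. *)
Let mapsC :=
  (bha_comm (infbh_assoc HA), infbh_alpha_psi HA, infbh_alpha_omega HA,
   infbh_beta_psi HA, infbh_beta_omega HA, bhc_comm (infbh_coassoc HA)).

(** * Coproducts of products and of iterated structure maps *)

Section TliftDelta.
Variables (W : lmodType K) (h : A -> A -> W).
Hypothesis h_bilin : bilin h.

Lemma tlift_DeltaE (f : A -> A) a : tmap f f (Delta a) = Delta (f a) ->
  tlift h (Delta (f a)) = tlift (fun u v => h (f u) (f v)) (Delta a).
Proof. by move=> <-; apply: tlift_tmap. Qed.

Lemma tlift_DeltaM a b :
  tlift h (Delta (a ∙ b)) =
    tlift (fun b1 b2 => h (omega a ∙ b1) (beta b2)) (Delta b)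
    + tlift (fun a1 a2 => h (alpha a1) (a2 ∙ psi b)) (Delta a)
    + lambda *: h (alpha (omega a)) (beta (psi b)).
Proof.
rewrite (infbh_deltaM HA) !tliftD // tlift_scale // tlift_tens // !tlift_tlift //.
by congr (_ + _ + _); apply: eq_tlift => u v; rewrite tlift_tens.
Qed.

End TliftDelta.

Let DeltaA a := infbh_alphaD HA a.
Let DeltaB a := infbh_betaD HA a.
Let DeltaPsi a := bhc_psiD (infbh_coassoc HA) a.
Let DeltaOmega a := bhc_omegaD (infbh_coassoc HA) a.

Lemma bilin_iter (W : lmodType K) (h : A -> A -> W) (f : {linear A -> A}) n :
  bilin h -> bilin (fun u v => h (iter n f u) (iter n f v)).
Proof.
elim: n h => [//|n IHn] h [hl hr] /=.
apply: (IHn (fun u v => h (f u) (f v))); split=> [v | u] k x y /=.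
  by rewrite linearP hl.
by rewrite linearP hr.
Qed.

Lemma tlift_Delta_iter (W : lmodType K) (h : A -> A -> W)
    (f : {linear A -> A}) n a :
  bilin h -> (forall x, tmap f f (Delta x) = Delta (f x)) ->
  tlift h (Delta (iter n f a)) =
    tlift (fun u v => h (iter n f u) (iter n f v)) (Delta a).
Proof.
move=> + fD; elim: n h => [//|n IHn] h hh /=.
by rewrite (tlift_DeltaE hh (fD _)) (IHn _ (bilin_iter f 1 hh)).
Qed.

(** The element [α^i β^j ψ^k ω^l (x)]. *)
Definition word i j k l x :=
  iter l omega (iter k psi (iter j beta (iter i alpha x))).

(** Each structure map commutes with Δ, so the blocks ω, ψ, β, α pass through it in turn. The
    function [h] absorbs the blocks already moved and must stay bilinear, whence [hl], [hk],
    [hj]. *)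
Lemma tlift_Delta_word (W : lmodType K) (h : A -> A -> W) i j k l a :
  bilin h ->
  tlift h (Delta (word i j k l a)) =
    tlift (fun u v => h (word i j k l u) (word i j k l v)) (Delta a).
Proof.
move=> hh; have hl := bilin_iter omega l hh; have hk := bilin_iter psi k hl.
have hj := bilin_iter beta j hk.
rewrite /word (tlift_Delta_iter _ _ hh DeltaOmega).
rewrite (tlift_Delta_iter _ _ hl DeltaPsi) (tlift_Delta_iter _ _ hk DeltaB).
by rewrite (tlift_Delta_iter _ _ hj DeltaA).
Qed.

(** The compatibility condition is applied to (xy)z, and again to xy in the middle summand; each
    application contributes one λ-term. *)
Lemma tlift_DeltaM3 (W : lmodType K) (h : A -> A -> W) x y z : bilin h ->
  tlift h (Delta (x ∙ y ∙ z)) =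
    tlift (fun z1 z2 => h (omega (x ∙ y) ∙ z1) (beta z2)) (Delta z)
    + tlift (fun y1 y2 => h (alpha (omega x ∙ y1)) (beta y2 ∙ psi z)) (Delta y)
    + tlift (fun x1 x2 => h (alpha (alpha x1)) (x2 ∙ psi y ∙ psi z)) (Delta x)
    + lambda *: h (alpha (alpha (omega x))) (beta (psi y) ∙ psi z)
    + lambda *: h (alpha (omega (x ∙ y))) (beta (psi z)).
Proof.
move=> hh; rewrite tlift_DeltaM // tlift_DeltaM ?addrA //.
split=> [v | u].
  have hv : linear (h^~ (v ∙ psi z)) by apply: hh.1.
  by move=> k u u'; rewrite linearP hv.
move=> k v v'; rewrite (linear_tensl _ (@linear_idfun _ _)) linearP.
exact: hh.2.
Qed.

(** * Compatibility of ⋆ with the structure maps *)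

Lemma star_pairE a b : star a b =
  tlift (fun u v => beta (beta (psi u)) ∙ alpha a ∙ P (omega v)) (Delta b).
Proof. by []. Qed.

(** Stated for a general [f] so as to cover α, β, ψ and ω, whose composites are the twisting maps of
    the pre-Lie structure. *)
Lemma star_morph (f : {linear A -> A}) a b :
  tmap f f (Delta b) = Delta (f b) ->
  (forall x y, f (x ∙ y) = f x ∙ f y) ->
  (forall x, f (alpha x) = alpha (f x)) ->
  (forall x, f (beta x) = beta (f x)) ->
  (forall x, f (psi x) = psi (f x)) ->
  (forall x, f (omega x) = omega (f x)) ->
  f (star a b) = star (f a) (f b).
Proof.
move=> fD fM fa fb fp fo; rewrite /star_pair (tlift_DeltaE _ fD).
  rewrite (linear_tliftE _ _ (@linearP _ _ _ _ f)); apply: eq_tlift => u v.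
  by rewrite !fM !(fa, fb, fp, fo).
by linear_tac.
Qed.

Lemma alpha_star a b : alpha (star a b) = star (alpha a) (alpha b).
Proof. by apply: star_morph => * //; rewrite ?mapsM ?mapsC. Qed.

Lemma beta_star a b : beta (star a b) = star (beta a) (beta b).
Proof. by apply: star_morph => * //; rewrite ?mapsM ?mapsC. Qed.

Lemma psi_star a b : psi (star a b) = star (psi a) (psi b).
Proof. by apply: star_morph => * //; rewrite ?mapsM ?mapsC. Qed.

Lemma omega_star a b : omega (star a b) = star (omega a) (omega b).
Proof. by apply: star_morph => * //; rewrite ?mapsM ?mapsC. Qed.

(** * Rebracketing, and the expansion of a double ⋆-product *)

Lemma mul_assoc4 p q r t :
  alpha p ∙ alpha q ∙ (r ∙ t) = p ∙ q ∙ r ∙ beta t.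
Proof. by rewrite -alphaM mul_assoc. Qed.

Lemma mul_assoc5 p q r s t :
  alpha (alpha p) ∙ alpha (alpha q) ∙ (r ∙ s ∙ t) =
  p ∙ q ∙ r ∙ beta s ∙ beta t.
Proof. by rewrite mul_assoc4 -alphaM mul_assoc. Qed.

(** The right side has the shape of (Q(a) ⋆ P(b)) ⋆ Q(c): the inner ⋆-product is the middle factor q
    r s. *)
Lemma mul_assoc5_inner p q r s t :
  alpha p ∙ alpha q ∙ alpha (beta r) ∙ (beta s ∙ t) =
  alpha (alpha p) ∙ (q ∙ r ∙ s) ∙ beta t.
Proof.
have -> : alpha p ∙ alpha q ∙ alpha (beta r) = alpha (alpha p) ∙ alpha (q ∙ r).
  by rewrite alphaM mul_assoc (bha_comm (infbh_assoc HA)).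
by rewrite mul_assoc4 -(mul_assoc (alpha p)).
Qed.

(** Common normal form of T1 and T3, with all brackets to the left; [a] and [b] sit between the
    three components of the iterated coproduct of [c]. [weight_term] is the analogue for T4 and
    T5. *)
Definition split_left_term a b c :=
  tlift (fun c1 c2 => tlift (fun u v =>
    word 0 4 2 0 u ∙ word 3 3 1 1 a ∙ word 2 3 1 1 v ∙ word 5 3 1 1 b
      ∙ word 4 3 1 2 c2) (Delta c1)) (Delta c).

Definition weight_term a b c :=
  tlift (fun c1 c2 =>
    word 1 4 2 1 c1 ∙ word 4 3 1 1 a ∙ word 5 3 1 1 b ∙ word 4 3 1 2 c2)
    (Delta c).

Lemma star_star a b c :
  star (P (Q a)) (star (P b) c) =
    split_left_term b a c + star (star (Q a) (P b)) (Q c)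
    + split_left_term a b c
    + lambda *: weight_term a b c + lambda *: weight_term b a c.
Proof.
rewrite [star (P b) c]star_pairE.
rewrite (linear_tliftE _ _ ((star_pair_bilin mu Delta alpha beta psi omega).2 _)).
(* Here x = β²ψ(c_1), y = αP(b), z = α²βω(c_2), and [h] is the function defining the outer ⋆. The
   five summands are T1 to T5 in order. *)
rewrite (eq_tlift _ (fun c1 c2 => tlift_DeltaM3 _ _ _ (star_inner_bilin mu alpha beta psi omega _))).
rewrite !tliftDfun !tliftZfun; congr (_ + _ + _ + _ *: _ + _ *: _).
(* T1: one ω is split off from the word on c_1, as the left side of coassociativity requires; the ψ
   missing from the word on [v] is then supplied by ψ(c_2). *)
- set F := fun x u v : A =>
    word 0 4 2 0 x ∙ word 3 3 1 1 b ∙ word 2 3 1 1 u ∙ word 5 3 1 1 a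
      ∙ word 4 3 0 2 v.
  transitivity (tlift (fun c1 c2 => tlift (F (omega c1)) (Delta c2)) (Delta c)).
    apply: eq_tlift => c1 c2.
    rewrite (_ : alpha (alpha (beta (omega c2))) = word 2 1 0 1 c2);
      last by rewrite /word /= !mapsC.
    rewrite tlift_Delta_word; last by linear_tac.
    by apply: eq_tlift => u v; rewrite /F /word /= !mapsM !mapsC.
  rewrite (tlift_coassoc (infbh_coassoc HA)); first last.
  + by move=> v w; rewrite /F /word /=; linear_tac.
  + by move=> u; rewrite /F /word /=; linear_tac.
  by do 2!apply: eq_tlift => ? ?; rewrite /F /word /= !mapsC.
- rewrite [RHS]star_pairE.
  rewrite (_ : Q c = word 2 2 1 1 c); last by rewrite /word /= !mapsC.
  rewrite tlift_Delta_word; last exact: star_inner_bilin.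
  apply: eq_tlift => c1 c2.
  rewrite (_ : alpha (P b) = word 3 1 0 0 b); last by rewrite /word /= !mapsC.
  rewrite (_ : P b = word 2 1 0 0 b); last by rewrite /word /= !mapsC.
  rewrite tlift_Delta_word; last by linear_tac.
  rewrite star_pairE tlift_Delta_word; last exact: star_inner_bilin.
  (* T2: the outer ⋆ as a linear function of its left argument, so that the sum over Δ(P(b)) can be
     pulled out. *)
  pose h x := beta (beta (psi (word 2 2 1 1 c1))) ∙ alpha x
                ∙ P (omega (word 2 2 1 1 c2)).
  rewrite -[RHS]/(h (tlift _ _)) linear_tliftE; last by rewrite /h; linear_tac.
  apply: eq_tlift => b1 b2.
  (* The exponents are those of the factors of T2 after removing the α's and β's that the lemma
     itself puts on its arguments; T3 and T4 are treated alike. *)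
  have := mul_assoc5_inner (word 0 4 2 1 c1) (word 3 3 1 0 b1)
    (word 4 2 1 1 a) (word 5 2 0 1 b2) (word 4 2 1 2 c2).
  by rewrite /h /word /= !mapsM !mapsC.
- apply: eq_tlift => c1 c2.
  rewrite (_ : beta (beta (psi c1)) = word 0 2 1 0 c1);
    last by rewrite /word /= !mapsC.
  rewrite tlift_Delta_word; last by linear_tac.
  apply: eq_tlift => u v.
  have := mul_assoc5 (word 0 4 2 0 u) (word 3 3 1 1 a) (word 2 3 1 1 v)
    (word 5 2 1 1 b) (word 4 2 1 2 c2).
  by rewrite /word /= !mapsM !mapsC.
- apply: eq_tlift => c1 c2.
  have := mul_assoc4 (word 1 4 2 1 c1) (word 4 3 1 1 a) (word 5 3 1 1 b)
    (word 4 2 1 2 c2).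
  by rewrite /word /= !mapsM !mapsC.
(* T5 already has all its brackets to the left. *)
- by apply: eq_tlift => c1 c2; rewrite /word /= !mapsM !mapsC.
Qed.

(** * The pre-Lie identity *)

Lemma map_PQ a : P (Q a) = Q (P a).
Proof. by rewrite !mapsC. Qed.

Lemma star_preLie a b c :
  star (P (Q a)) (star (P b) c) - star (star (Q a) (P b)) (Q c) =
  star (P (Q b)) (star (P a) c) - star (star (Q b) (P a)) (Q c).
Proof.
(* The second summand [y] is T2, the term subtracted in the associator. *)
have cancel (x y z t u : A) : x + y + z + t + u - y = x + z + t + u.
  by rewrite (addrC x) -!addrA addrC !addrA subrK.
by rewrite !star_star !cancel (addrC (split_left_term b a c)) addrAC.
Qed.

End InfBHBialgebra.

Unset Implicit Arguments.

Theorem theorem3p27 (K : fieldType) (lambda : K) (A : lmodType K)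
    (mu : {linear (A ⊗ A)%type -> A}) (Delta : {linear A -> (A ⊗ A)%type})
    (alpha beta psi omega : {linear A -> A})
    (HA : is_infBH_bialgebra lambda mu Delta alpha beta psi omega) :
  is_BiHom_preLie
    (infbh_star mu Delta alpha beta psi omega)
    (alpha \o alpha \o beta)
    (alpha \o alpha \o beta \o beta \o psi \o omega).
Proof.
split=> [a | a b | a b | a b c] /=.
- exact: map_PQ HA a.
- by rewrite !infbh_starE (beta_star HA) !(alpha_star HA).
- rewrite !infbh_starE (omega_star HA) (psi_star HA) !(beta_star HA).
  by rewrite !(alpha_star HA).
- by rewrite !infbh_starE; apply: star_preLie HA a b c.
Qed.
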